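(* Let $\Omega\subset\mathbb{R}^n$ be a domain with $\mathrm{width}(\Omega)<+\infty$, let $f\in L^\infty(\Omega)$ and $g\in C(\partial\Omega)\cap L^\infty(\partial\Omega)$, and let $(\varepsilon_i)_{i\ge1}$ be a sequence of positive numbers with $\varepsilon_i\to 0$. For each $i$ let $u_i:\overline{\Omega}\to\mathbb{R}$ be a bounded solution of \[ \begin{cases}\Delta_\infty^{\varepsilon_i}u_i(x)=\varepsilon_i^2 f(x), & x\in\Omega,\\ u_i(x)=g(x), & x\in\partial\Omega.\end{cases} \] Then there exists a subsequence of $(u_i)$ converging locally uniformly to some $u\in C(\overline{\Omega})$.
   Context: A domain is an open connected subset of $\mathbb{R}^n$; $\overline\Omega$ is its closure and $\partial\Omega$ its boundary. $d(x,y)$ denotes the intrinsic metric of $\overline\Omega$: the infimum of the lengths of paths in $\overline\Omega$ from $x$ to $y$. $\mathrm{width}(\Omega)=\sup_{x\in\Omega} d(\partial\Omega,x)$, where $d(\partial\Omega,x)=\inf_{y\in\partial\Omega}d(y,x)$. For $\varepsilon>0$, $B_x(\varepsilon)=\{y\in\overline\Omega: d(x,y)<\varepsilon\}$ and for $w:\overline\Omega\to\mathbb{R}$, $\Delta^{\varepsilon}_\infty w(x)=\inf_{y\in B_x(\varepsilon)}w(y)+\sup_{y\in B_x(\varepsilon)}w(y)-2w(x)$. *)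

(* Defs.v *)
From HB Require Import structures.
From mathcomp Require Import all_boot all_order all_algebra.
From mathcomp Require Import all_classical all_reals all_analysis.
Set Implicit Arguments. Unset Strict Implicit. Unset Printing Implicit Defensive.
Import Order.TTheory GRing.Theory Num.Theory.
Import numFieldNormedType.Exports.
Local Open Scope classical_set_scope.
Local Open Scope ring_scope.

Section Defs.
Variables (R : realType) (n : nat).
Notation V := 'rV[R]_n.

(* Euclidean norm on R^n (the library norm on 'rV is the sup norm). *)
Definition eucl (x : V) : R := Num.sqrt (\sum_(i < n) (x ord0 i) ^+ 2).

Definition is_partition (s : nat -> R) (k : nat) : Prop :=
  s 0%N = 0 /\ s k = 1 /\ (forall i, (i < k)%N -> s i <= s i.+1).

Definition partition_sum (g : R -> V) (s : nat -> R) (k : nat) : R :=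
  \sum_(i < k) eucl (g (s i.+1) - g (s i)).

Definition curve_length (g : R -> V) : \bar R :=
  ereal_sup [set l | exists s k, is_partition s k /\ l = (partition_sum g s k)%:E].

Definition path_in (D : set V) (x y : V) (g : R -> V) : Prop :=
  {within [set t : R | 0 <= t <= 1], continuous g} /\
  (forall t : R, 0 <= t <= 1 -> closure D (g t)) /\ g 0 = x /\ g 1 = y.

(* Intrinsic metric of closure D (value +oo if no rectifiable path). *)
Definition idist (D : set V) (x y : V) : \bar R :=
  ereal_inf [set curve_length g | g in [set g | path_in D x y g]].

Definition bdry (D : set V) : set V := closure D `\` D.

Definition dist_bdry (D : set V) (x : V) : \bar R :=
  ereal_inf [set idist D y x | y in bdry D].

Definition width (D : set V) : \bar R :=
  ereal_sup [set dist_bdry D x | x in D].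

Definition iball (D : set V) (x : V) (e : R) : set V :=
  [set y | closure D y /\ (idist D x y < e%:E)%E].

Definition eps_inf_lap (D : set V) (e : R) (w : V -> R) (x : V) : R :=
  inf (w @` iball D x e) + sup (w @` iball D x e) - 2 * w x.

Definition domain (D : set V) : Prop := open D /\ connected D /\ D !=set0.

End Defs.

(* Main.v *)
(** The intrinsic distance [t] to a set [Z] satisfies the eikonal-type relations
    sup t <= t + e and inf t <= t - e on e-balls, because a path can be cut at any
    prescribed arc length. Hence a concave quadratic function of [t] is a strict
    supersolution of the e-difference equation away from [Z], and comparison with a
    strict supersolution needs no uniqueness theory. Taking for [Z] the boundary bounds
    the solutions uniformly, the width being finite. Taking a single point gives, up
    to an error of order [e], a Lipschitz estimate in the interior and a modulus of
    continuity at the boundary. Near a boundary point [x], the intrinsic distance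
    to [x] may be large, so one compares at the first exit point of the Euclidean
    segment towards [x] instead. The conclusion follows from an Arzela-Ascoli argument
    for functions that are equicontinuous only asymptotically. *)

Require Import Defs.
From HB Require Import structures.
From mathcomp Require Import all_boot all_order all_algebra.
From mathcomp Require Import all_classical all_reals all_analysis.
From mathcomp Require Import lra ring zify.
Set Implicit Arguments. Unset Strict Implicit. Unset Printing Implicit Defensive.
Import Order.TTheory GRing.Theory Num.Theory.
Import numFieldNormedType.Exports.
Local Open Scope classical_set_scope.
Local Open Scope ring_scope.

(** * The Euclidean norm and its comparison with the sup norm *)

Section EuclideanNorm.
Variables (R : realType) (n : nat).
Implicit Types x y : 'rV[R]_n.

Lemma eucl_ge0 x : 0 <= eucl x.
Proof. exact: sqrtr_ge0. Qed.

Lemma eucl_sqr x : eucl x ^+ 2 = \sum_(i < n) x ord0 i ^+ 2.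
Proof. by rewrite sqr_sqrtr// sumr_ge0// => i _; rewrite sqr_ge0. Qed.

Lemma euclZ a x : eucl (a *: x) = `|a| * eucl x.
Proof.
rewrite /eucl -sqrtr_sqr -sqrtrM ?sqr_ge0// mulr_sumr.
by congr Num.sqrt; apply: eq_bigr => i _; rewrite mxE exprMn.
Qed.

Lemma euclN x : eucl (- x) = eucl x.
Proof. by rewrite -scaleN1r euclZ normrN1 mul1r. Qed.

Lemma eucl_distC x y : eucl (x - y) = eucl (y - x).
Proof. by rewrite -euclN opprB. Qed.

Lemma eucl0 : eucl (0 : 'rV[R]_n) = 0.
Proof. by rewrite -(scale0r 0) euclZ normr0 mul0r. Qed.

Lemma coord_le_eucl x i : `|x ord0 i| <= eucl x.
Proof.
rewrite -sqrtr_sqr ler_sqrt ?sumr_ge0// => [|j _]; last by rewrite sqr_ge0.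
by rewrite (bigD1 i)//= lerDl sumr_ge0// => j _; rewrite sqr_ge0.
Qed.

Lemma eucl_eq0 x : eucl x = 0 -> x = 0.
Proof.
move=> x0; apply/rowP => i; rewrite mxE; apply/eqP; rewrite -normr_le0 -x0.
exact: coord_le_eucl.
Qed.

Lemma norm_le_eucl x : `|x| <= eucl x.
Proof.
rewrite (_ : `|x| = mx_norm x)// mx_normrE.
apply/bigmax_leP => /=; split; first exact: eucl_ge0.
by move=> [i j] _ /=; rewrite (ord1 i); exact: coord_le_eucl.
Qed.

Lemma eucl_le_norm x : eucl x <= Num.sqrt n%:R * `|x|.
Proof.
rewrite -[X in _ * X]ger0_norm// -sqrtr_sqr -sqrtrM ?ler0n//.
rewrite ler_sqrt; last by rewrite mulr_ge0 ?sqr_ge0 ?ler0n.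
have -> : n%:R * `|x| ^+ 2 = \sum_(i < n) `|x| ^+ 2.
  by rewrite sumr_const card_ord mulr_natl.
apply: ler_sum => i _; rewrite -real_normK ?num_real// ler_pXn2r ?nnegrE//.
rewrite (_ : `|x| = mx_norm x)// mx_normrE.
exact: (le_bigmax 0 (fun ij => `|x ij.1 ij.2|) (ord0, i)).
Qed.

Lemma eucl_triangle x y : eucl (x + y) <= eucl x + eucl y.
Proof.
have [x0|x0] := eqVneq (eucl x) 0.
  by rewrite (eucl_eq0 x0) add0r lerDr eucl_ge0.
have [y0|y0] := eqVneq (eucl y) 0.
  by rewrite (eucl_eq0 y0) addr0 lerDl eucl_ge0.
have {x0} xp : 0 < eucl x by rewrite lt_def x0 eucl_ge0.
have {y0} yp : 0 < eucl y by rewrite lt_def y0 eucl_ge0.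
rewrite -(ler_pXn2r (n := 2)) ?nnegrE ?addr_ge0 ?eucl_ge0// eucl_sqr.
set a := eucl x; set b := eucl y.
(* AM-GM in each coordinate: [2 x_i y_i <= (b / a) x_i^2 + (a / b) y_i^2]. *)
have -> : (a + b) ^+ 2 =
    (1 + b / a) * a ^+ 2 + (1 + a / b) * b ^+ 2.
  by field; rewrite !gt_eqF.
rewrite !eucl_sqr !mulr_sumr -big_split/=; apply: ler_sum => i _.
rewrite mxE; set s := x _ _; set t := y _ _.
have -> : (1 + b / a) * s ^+ 2 + (1 + a / b) * t ^+ 2 =
    (s + t) ^+ 2 + (b * s - a * t) ^+ 2 / (a * b).
  by field; rewrite !gt_eqF.
by rewrite lerDl divr_ge0 ?sqr_ge0// mulr_ge0 ?eucl_ge0.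
Qed.

Lemma eucl_continuous : continuous (@eucl R n).
Proof.
move=> x; apply: (@continuous_comp _ _ _ (fun x => \sum_(i < n) x ord0 i ^+ 2)
  (@Num.sqrt R) x _ (@sqrt_continuous R _)).
apply: (@cvg_big R^o _ _ _ _ (@add_continuous R^o) _ (nbhs x) _ _ _
  (nbhs_filter x)) => i _.
by apply: cvgM; exact: coord_continuous.
Qed.

End EuclideanNorm.

(** * Lengths of paths on subintervals, and cutting at a given length *)

Section PathLength.
Variables (R : realType) (n : nat).
Notation V := 'rV[R]_n.
Implicit Types (g : R -> V) (a b c l : R) (s : nat -> R) (k : nat).

Definition partition_on a b s k :=
  [/\ s 0%N = a, s k = b & forall i, (i < k)%N -> s i <= s i.+1].

(** Bounding all partition sums by a real number avoids extended real suprema. *)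
Definition length_le g a b l :=
  forall s k, partition_on a b s k -> partition_sum g s k <= l.

Lemma partition_on_le a b s k i j :
  partition_on a b s k -> (i <= j)%N -> (j <= k)%N -> s i <= s j.
Proof.
move=> [_ _ sS]; elim: j => [|j IHj]; first by rewrite leqn0 => /eqP->.
rewrite leq_eqVlt => /predU1P[->//|ij jk].
exact: le_trans (IHj ij (ltnW jk)) (sS _ jk).
Qed.

Lemma partition_on_in a b s k i :
  partition_on a b s k -> (i <= k)%N -> a <= s i <= b.
Proof.
move=> psk ik; have [s0 sk _] := psk.
by rewrite -s0 -sk (partition_on_le psk (leq0n _) ik) (partition_on_le psk ik).
Qed.

Lemma partition_chord a b : a <= b ->
  partition_on a b (fun i => if i is 0%N then a else b) 1.
Proof. by move=> ab; split => // -[]. Qed.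

Lemma length_le_chord g a b l :
  a <= b -> length_le g a b l -> eucl (g b - g a) <= l.
Proof.
move=> ab /(_ _ _ (partition_chord ab)).
by rewrite /partition_sum big_ord_recl big_ord0/= addr0.
Qed.

Lemma length_le_refl g a l : 0 <= l -> length_le g a a l.
Proof.
move=> l0 s k psk; rewrite /partition_sum big1// => i _.
have sE j : (j <= k)%N -> s j = a.
  by move=> /(partition_on_in psk) => H; apply: le_anti; rewrite andbC.
by rewrite !sE ?subrr ?eucl0// ltnW.
Qed.

(** Length is superadditive: gluing the two partitions at [c] gives a partition from [a] to [b]. *)
Lemma length_le_cat g a b c l s1 k1 s2 k2 : length_le g a b l ->
  partition_on a c s1 k1 -> partition_on c b s2 k2 ->
  partition_sum g s1 k1 + partition_sum g s2 k2 <= l.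
Proof.
move=> gl [s10 s1k s1S] [s20 s2k s2S].
pose s i := if (i <= k1)%N then s1 i else s2 (i - k1)%N.
have s1E i : (i <= k1)%N -> s i = s1 i by rewrite /s => ->.
have s2E i : s (k1 + i)%N = s2 i.
  rewrite /s; case: i => [|i]; first by rewrite addn0 leqnn s20 s1k.
  by rewrite leqNgt addnS ltnS leq_addr/= -addnS addKn.
have psk : partition_on a b s (k1 + k2).
  split; [by rewrite s1E|by rewrite s2E|move=> i ik].
  have [ik1|k1i] := ltnP i k1; first by rewrite !s1E ?s1S// ltnW.
  by rewrite -(subnKC k1i) -addnS !s2E s2S// ltn_subLR.
apply: le_trans (gl _ _ psk); rewrite /partition_sum big_split_ord/=.
rewrite le_eqVlt; apply/orP; left; apply/eqP; congr (_ + _); apply: eq_bigr => i _ /=.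
  by rewrite !s1E ?ltn_ord// ltnW.
by rewrite -addnS !s2E.
Qed.

Lemma length_le_reparam g a b l (h : R -> R) :
  {homo h : x y / x <= y} -> h 0 = a -> h 1 = b ->
  length_le g a b l -> length_le (g \o h) 0 1 l.
Proof.
move=> hh h0 h1 gl s k [s0 sk sS]; apply: (gl (h \o s)).
by split => [||i ik] /=; rewrite ?s0 ?sk//; exact/hh/sS.
Qed.

Lemma length_le_rev g l :
  length_le g 0 1 l -> length_le (fun t => g (1 - t)) 0 1 l.
Proof.
move=> gl s k [s0 sk sS].
have psk : partition_on 0 1 (fun i => 1 - s (k - i)%N) k.
  split; rewrite ?subn0 ?subnn ?sk ?s0 ?subrr ?subr0// => i ik.
  rewrite lerD2l lerN2 -[in leRHS](subnSK ik).
  by apply: sS; lia.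
apply: le_trans (gl _ _ psk); rewrite /partition_sum (reindex_inj rev_ord_inj)/=.
by apply: ler_sum => i _; rewrite subnSK// eucl_distC.
Qed.

(** Serves for concatenation, written as a sum of two paths one of which rests while the other
    moves. *)
Lemma length_leD g1 g2 l1 l2 v :
  length_le g1 0 1 l1 -> length_le g2 0 1 l2 ->
  length_le (fun t => g1 t + g2 t - v) 0 1 (l1 + l2).
Proof.
move=> gl1 gl2 s k psk; apply: le_trans (lerD (gl1 _ _ psk) (gl2 _ _ psk)).
rewrite /partition_sum -big_split/=; apply: ler_sum => i _.
rewrite (_ : _ - _ - _ = (g1 (s i.+1) - g1 (s i)) + (g2 (s i.+1) - g2 (s i))).
  exact: eucl_triangle.
by rewrite opprB addrA subrK opprD addrACA.
Qed.

Lemma partition_sum_continuous g k (S : nat -> R -> R) t :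
  continuous g -> (forall i, {for t, continuous (S i)}) ->
  {for t, continuous (fun u => partition_sum g (S^~ u) k)}.
Proof.
move=> gc Sc.
apply: (@cvg_big R^o _ _ _ _ (@add_continuous R^o) _ (nbhs t) _ _ _
  (nbhs_filter t)) => i _.
apply: (@continuous_comp _ _ _ (fun u => g (S i.+1 u) - g (S i u)) (@eucl R n)).
  by apply: cvgB; apply: (@continuous_comp _ _ _ _ g); rewrite ?Sc//; exact: gc.
exact: eucl_continuous.
Qed.

(* Clipping a partition of [a, sup T] at [u <= sup T] changes its sum continuously,
   so the length is lower semicontinuous in its endpoint. *)
Lemma length_le_sup g a l (T : set R) : continuous g -> has_sup T ->
  (forall t, T t -> a <= t /\ length_le g a t l) -> length_le g a (sup T) l.
Proof.
move=> gc Tsup Tl s k psk; have [s0 sk sS] := psk; rewrite leNgt; apply/negP => lt_l.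
set t := sup T in sk psk lt_l *.
pose S i u := Num.min (s i) u.
have Sc i : {for t, continuous (S i)}.
  apply: continuous_min; [exact: cvg_cst|exact: cvg_id].
have SE : partition_sum g (S^~ t) k = partition_sum g s k.
  apply: eq_bigr => i _; have [/andP[_ it] /andP[_ it1]] :=
    (partition_on_in psk (ltnW (ltn_ord i)), partition_on_in psk (ltn_ord i)).
  by rewrite /S !min_l.
have : partition_sum g (S^~ u) k @[u --> t] --> partition_sum g s k.
  by rewrite -SE; exact: (partition_sum_continuous gc Sc).
move=> /cvgr_gt /(_ _ lt_l) /nbhs_ballP[d /= d0 dP].
have [u Tu ltu] := sup_adherent d0 Tsup.
have le_ut : u <= t by apply: sup_upper_bound.
have /(_ _)/= := dP u.
have tu : ball t d u by rewrite /ball/= ger0_norm ?subr_ge0// ltrBlDr -ltrBlDl.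
move=> /(_ tu); apply/negP; rewrite -leNgt; apply: (Tl _ Tu).2; split.
- by rewrite /S s0 min_l//; exact: (Tl _ Tu).1.
- by rewrite /S sk min_r.
- by move=> i ik; rewrite /S le_min !ge_min (sS _ ik) lexx orbT.
Qed.

(** Clipping a partition from below at [u], slightly above [t], changes its sum continuously, so the
    bound passes to the left endpoint. *)
Lemma length_le_inf g t b l : continuous g -> t < b ->
  (forall u, t < u -> u <= b -> length_le g u b l) -> length_le g t b l.
Proof.
move=> gc tb gl s k psk; have [s0 sk sS] := psk; rewrite leNgt; apply/negP => lt_l.
pose S i u := Num.max (s i) u.
have Sc i : {for t, continuous (S i)}.
  apply: continuous_max; [exact: cvg_cst|exact: cvg_id].
have SE : partition_sum g (S^~ t) k = partition_sum g s k.
  apply: eq_bigr => i _; have [/andP[it _] /andP[it1 _]] :=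
    (partition_on_in psk (ltnW (ltn_ord i)), partition_on_in psk (ltn_ord i)).
  by rewrite /S !max_l.
have : partition_sum g (S^~ u) k @[u --> t] --> partition_sum g s k.
  by rewrite -SE; exact: (partition_sum_continuous gc Sc).
move=> /cvgr_gt /(_ _ lt_l) /nbhs_ballP[d /= d0 dP].
pose u := Num.min (t + d / 2) b.
have tu : t < u by rewrite lt_min tb ltrDl divr_gt0.
have ub : u <= b by rewrite ge_min lexx orbT.
have ball_u : ball t d u.
  rewrite /ball/= distrC gtr0_norm ?subr_gt0// ltrBlDl.
  by rewrite gt_min ltrD2l ltr_pdivrMr// ltr_pMr// ltr1n.
have /(_ ball_u)/= := dP u.
apply/negP; rewrite -leNgt; apply: (gl _ tu ub); split.
- by rewrite /S s0 max_r// ltW.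
- by rewrite /S sk max_l.
- by move=> i ik; rewrite /S ge_max !le_max (sS _ ik) lexx orbT.
Qed.

(** The cut is the supremum of the times up to which the length is at most [a]. Beyond it some
    partition sum exceeds [a], and superadditivity leaves at most [l - a] for the rest;
    semicontinuity at both ends closes the gap. *)
Lemma length_le_split g l a : continuous g -> length_le g 0 1 l ->
  0 <= a <= l ->
  exists2 t, 0 <= t <= 1 & length_le g 0 t a /\ length_le g t 1 (l - a).
Proof.
move=> gc gl /andP[a0 al].
pose T := [set t | 0 <= t <= 1 /\ length_le g 0 t a].
have T0 : T 0 by split; [rewrite lexx ler01|exact: length_le_refl].
have T1 : ubound T 1 by move=> t [/andP[]].
have Ts : has_sup T by split; [exists 0|exists 1].
have t0 : 0 <= sup T by exact: sup_upper_bound.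
have t1 : sup T <= 1 by apply: ge_sup => //; exists 0.
exists (sup T); first by rewrite t0.
split; first by apply: length_le_sup => // t [/andP[]].
move: t1; rewrite le_eqVlt => /predU1P[->|t1].
  by apply: length_le_refl; rewrite subr_ge0.
apply: length_le_inf => // u tu u1.
have : ~ length_le g 0 u a.
  move=> gu; suff /(sup_upper_bound Ts) : T u by rewrite leNgt tu.
  by split=> //; rewrite u1 (le_trans t0 (ltW tu)).
move=> /existsNP[s1 /existsNP[k1 /not_implyP[ps1 /negP]]].
rewrite -ltNge => lt_a s2 k2 ps2; rewrite lerBrDl.
exact: le_trans (lerD (ltW lt_a) (lexx _)) (length_le_cat gl ps1 ps2).
Qed.

End PathLength.

(** * The intrinsic distance: metric properties and intermediate points *)

Section IntrinsicDistance.
Variables (R : realType) (n : nat) (D : set 'rV[R]_n).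
Notation V := 'rV[R]_n.
Implicit Types (x y z : V) (e l s : R) (g : R -> V).

(** Trades the infimum for a witness. Clamping time to the unit interval extends the path by
    constants, so that it is continuous on the whole line. *)
Lemma idist_ltP x y e : (idist D x y < e%:E)%E <->
  exists g l, [/\ continuous g, forall t, closure D (g t), g 0 = x, g 1 = y &
    length_le g 0 1 l] /\ l < e.
Proof.
split.
  move=> /ereal_inf_lt[_ [g [gc [gD [g0 g1]]] <-]] gle.
  pose c (t : R) : R := Num.max 0 (Num.min t 1).
  have c01 t : 0 <= c t <= 1.
    by rewrite /c le_max lexx/= ge_max ler01/= ge_min lexx orbT.
  have cid t : 0 <= t <= 1 -> c t = t.
    by move=> /andP[t0 t1]; rewrite /c min_l// max_r.
  have cc t : {for t, continuous c}.
    apply: continuous_max; first exact: cvg_cst.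
    by apply: continuous_min; [exact: cvg_id|exact: cvg_cst].
  have gl (s : nat -> R) k : partition_on 0 1 s k ->
      ((partition_sum (g \o c) s k)%:E <= curve_length g)%E.
    move=> psk; apply: ereal_sup_ubound; exists s, k; split.
      by case: psk => *; do !split.
    congr EFin; apply: eq_bigr => i _ /=.
    by rewrite !cid// (partition_on_in psk)// ltnW.
  have Lfin : curve_length g \is a fin_num.
    rewrite fin_real// (lt_trans gle) ?ltry// andbT.
    apply: lt_le_trans (gl _ _ (partition_chord ler01)).
    by rewrite ltNyr.
  exists (g \o c), (fine (curve_length g)); split; last first.
    by rewrite -lte_fin fineK.
  split => [t|t| | |s k /gl].
  - apply: (@cvg_comp _ _ _ c g _ (within [set t : R | 0 <= t <= 1] (nbhs (c t)))).
      move=> P; rewrite /within/= => /cc.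
      by apply: (@filterS _ (nbhs t)) => u; apply; exact: c01.
    by move/subspace_continuousP : gc; apply; exact: c01.
  - exact/gD/c01.
  - by rewrite /= cid ?lexx ?ler01.
  - by rewrite /= cid ?lexx ?ler01.
  - by rewrite -lee_fin fineK.
move=> [g [l [[gc gD g0 g1 gl] le]]].
apply: (@le_lt_trans _ _ l%:E); last by rewrite lte_fin.
apply: (@le_trans _ _ (curve_length g)).
  apply: ereal_inf_lbound; exists g => //; split; first exact: continuous_subspaceT.
  by split => // t _; exact: gD.
apply: ub_ereal_sup => _ [s [k [[s0 [sk sS]] ->]]]; rewrite lee_fin.
exact: gl.
Qed.

Lemma idist_sym x y : idist D x y = idist D y x.
Proof.
have H x' y' e : (idist D x' y' < e%:E)%E -> (idist D y' x' < e%:E)%E.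
  move=> /idist_ltP[g [l [[gc gD g0 g1 gl] le]]]; apply/idist_ltP.
  exists (fun t => g (1 - t)), l; split=> //; split => [t|t|||].
  - apply: (@continuous_comp R R V (fun t => 1 - t) g); last exact: gc.
    by apply: cvgB; [exact: cvg_cst|exact: cvg_id].
  - exact: gD.
  - by rewrite subr0.
  - by rewrite subrr.
  - exact: length_le_rev.
suff H2 x' y' : (idist D x' y' <= idist D y' x')%E by apply/le_anti; rewrite !H2.
rewrite leNgt; apply/negP => lt.
have [r /andP[]] : exists r, (idist D y' x' < r%:E < idist D x' y')%E.
  move: lt; case: (idist D y' x') => [a| |]; case: (idist D x' y') => [b| |]//=.
  - by rewrite lte_fin => ab; exists ((a + b) / 2); rewrite !lte_fin !midf_lt.
  - by exists (a + 1); rewrite lte_fin ltrDl ltr01 ltry.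
  - by exists (b - 1); rewrite lte_fin ltrBlDr ltrDl ltr01 ltNyr.
  - by exists 0; rewrite ltNyr ltry.
by move=> /H /lt_trans h /h; rewrite ltxx.
Qed.

Lemma idist_eucl x y e : (idist D x y < e%:E)%E -> eucl (y - x) < e.
Proof.
move=> /idist_ltP[g [l [[_ _ <- <- gl] le]]].
exact: le_lt_trans (length_le_chord ler01 gl) le.
Qed.

Lemma idist_closure x y e : (idist D x y < e%:E)%E -> closure D x /\ closure D y.
Proof. by move=> /idist_ltP[g [l [[_ gD <- <- _] _]]]. Qed.

Lemma idist_triangle x y z e1 e2 : (idist D x y < e1%:E)%E ->
  (idist D y z < e2%:E)%E -> (idist D x z < (e1 + e2)%:E)%E.
Proof.
move=> /idist_ltP[g1 [l1 [[g1c g1D g10 g11 g1l] le1]]].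
move=> /idist_ltP[g2 [l2 [[g2c g2D g20 g21 g2l] le2]]].
apply/idist_ltP.
(* [h1] runs during the first half of the time and [h2] during the second. The resting path sits at
   [y], which the subtraction of [y] cancels. *)
pose h1 (t : R) : R := Num.min (2 * t) 1; pose h2 (t : R) : R := Num.max (2 * t - 1) 0.
have c2 : continuous (fun t : R => 2 * t).
  by move=> t; apply: cvgM; [exact: cvg_cst|exact: cvg_id].
have h1c t : {for t, continuous h1}.
  by apply: continuous_min; [exact: c2|exact: cvg_cst].
have h2c t : {for t, continuous h2}.
  apply: continuous_max; last exact: cvg_cst.
  by apply: cvgB; [exact: c2|exact: cvg_cst].
exists (fun t => g1 (h1 t) + g2 (h2 t) - y), (l1 + l2).
split; last exact: ltrD.
split => [t|t| | |].
- apply: cvgB; last exact: cvg_cst.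
  by apply: cvgD; apply: (@continuous_comp _ _ _ _ _ t); rewrite ?h1c ?h2c//;
    [exact: g1c|exact: g2c].
- have [t1|t1] := leP (2 * t) 1.
    rewrite /h2 max_r ?subr_le0// g20 addrK; exact: g1D.
  rewrite /h1 min_r ?ltW// g11 [y + _]addrC addrK; exact: g2D.
- by rewrite /h1 /h2 mulr0 min_l ?ler01// max_r ?subr_le0 ?ler01// g10 g20 addrK.
- rewrite /h1 /h2 mulr1 min_r ?ler1n// max_l; last by rewrite subr_ge0 ler1n.
  have -> : 2 - 1 = 1 :> R by lra.
  by rewrite g11 g21 addrAC subrr add0r.
- apply: length_leD.
    apply: (@length_le_reparam _ _ g1 0 1 l1 h1) => //.
    + by move=> a b ab; rewrite /h1; apply: le_min2; rewrite ?ler_pM2l.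
    + by rewrite /h1 mulr0 min_l.
    + by rewrite /h1 mulr1 min_r// ler1n.
  apply: (@length_le_reparam _ _ g2 0 1 l2 h2) => //.
  + by move=> a b ab; rewrite /h2; apply: le_max2; rewrite ?lerD2r ?ler_pM2l.
  + by rewrite /h2 mulr0 max_r// subr_le0.
  + by rewrite /h2 mulr1 max_l; lra.
Qed.

Lemma idist_segment x y e : (forall t, 0 <= t <= 1 -> closure D (x + t *: (y - x))) ->
  eucl (y - x) < e -> (idist D x y < e%:E)%E.
Proof.
move=> segD xye.
apply: le_lt_trans (_ : ((eucl (y - x))%:E < _)%E); last by rewrite lte_fin.
pose g (t : R) := x + t *: (y - x).
apply: (@le_trans _ _ (curve_length g)).
  apply: ereal_inf_lbound; exists g => //; split; last split.
  - apply: continuous_subspaceT => t; apply: cvgD; first exact: cvg_cst.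
    by apply: cvgZr_tmp; exact: cvg_id.
  - by move=> t /segD.
  - by rewrite /g scale0r scale1r addr0 addrC subrK.
apply: ub_ereal_sup => _ [s [k [[s0 [sk sS]] ->]]]; rewrite lee_fin.
rewrite /partition_sum.
have -> : \sum_(i < k) eucl (g (s i.+1) - g (s i)) =
    \sum_(i < k) (s i.+1 - s i) * eucl (y - x).
  apply: eq_bigr => i _; rewrite /g opprD addrACA subrr add0r -scalerBl euclZ.
  by rewrite ger0_norm// subr_ge0 sS.
rewrite -mulr_suml -(big_mkord xpredT (fun i => s i.+1 - s i)) telescope_sumr//.
by rewrite s0 sk subr0 mul1r.
Qed.

Lemma idist_refl x e : closure D x -> 0 < e -> (idist D x x < e%:E)%E.
Proof.
move=> Dx e0; apply: idist_segment; last by rewrite subrr eucl0.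
by move=> t _; rewrite subrr scaler0 addr0.
Qed.

(** This is where an intrinsic metric is needed: a step of size [e] from [x] can reduce the distance
    to [z] by [e], with strict inequalities on both sides. *)
Lemma idist_split x z s e : (idist D z x < s%:E)%E -> 0 < e -> e < s ->
  exists y, (idist D x y < e%:E)%E /\ (idist D z y < (s - e)%:E)%E.
Proof.
move=> /idist_ltP[g [l [[gc gD g0 g1 gl] ls]]] e0 es.
(* The path is cut at length [a = l' - e + d]. Here [e <= l'] and [d <= e] give [0 <= a <= l'],
   [0 < d] leaves a rest shorter than [e], and [d < s - l'] gives [a < s - e]. *)
pose l' := Num.max l e.
have gl' : length_le g 0 1 l'.
  by move=> p k /gl /le_trans -> //; rewrite le_max lexx.
have l's : l' < s by rewrite gt_max ls.
have el' : e <= l' by rewrite le_max lexx orbT.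
pose d := Num.min ((s - l') / 2) e.
have d0 : 0 < d by rewrite lt_min e0 divr_gt0 ?subr_gt0.
have de : d <= e by rewrite ge_min lexx orbT.
have ds : d < s - l'.
  by rewrite gt_min ltr_pdivrMr// ltr_pMr ?ltr1n// subr_gt0.
pose a := l' - e + d.
have [|t /andP[t0 t1] [gt1 gt2]] := length_le_split (a := a) gc gl'.
  by rewrite /a; apply/andP; split; lra.
exists (g t); split.
- rewrite idist_sym; apply/idist_ltP.
  exists (g \o (fun u => t + u * (1 - t))), (l' - a); split; last by rewrite /a; lra.
  split => [u|u| | |] /=.
  + apply: (@continuous_comp _ _ _ _ g); last exact: gc.
    by apply: cvgD; [exact: cvg_cst|apply: cvgM; [exact: cvg_id|exact: cvg_cst]].
  + exact: gD.
  + by rewrite mul0r addr0.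
  + by rewrite mul1r addrC subrK.
  + apply: (@length_le_reparam _ _ g t 1) => //.
    * by move=> u v uv; rewrite lerD2l ler_wpM2r// subr_ge0.
    * by rewrite mul0r addr0.
    * by rewrite mul1r addrC subrK.
- apply/idist_ltP.
  exists (g \o (fun u => u * t)), a; split; last by rewrite /a; lra.
  split => [u|u| | |] /=.
  + apply: (@continuous_comp _ _ _ _ g); last exact: gc.
    by apply: cvgM; [exact: cvg_id|exact: cvg_cst].
  + exact: gD.
  + by rewrite mul0r.
  + by rewrite mul1r.
  + apply: (@length_le_reparam _ _ g 0 t) => //.
    * by move=> u v uv; rewrite ler_wpM2r.
    * by rewrite mul0r.
    * by rewrite mul1r.
Qed.

End IntrinsicDistance.

(** * Truncated distance to a set and the comparison principle *)

Section Barrier.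
Variables (R : realType) (n : nat) (D : set 'rV[R]_n).
Notation V := 'rV[R]_n.
Implicit Types (x y z : V) (Z : set V) (e r s t : R).

Definition set_idist Z x : \bar R := ereal_inf [set idist D z x | z in Z].

Lemma set_idist_ltP Z x s : (set_idist Z x < s%:E)%E <->
  exists2 z, Z z & (idist D z x < s%:E)%E.
Proof.
split=> [/ereal_inf_lt[_ [z Zz <-] zs]|[z Zz zs]]; first by exists z.
by apply: le_lt_trans zs; apply: ereal_inf_lbound; exists z.
Qed.

Lemma set_idist1 z x : set_idist [set z] x = idist D z x.
Proof. by rewrite /set_idist image_set1 ereal_inf1. Qed.

Lemma set_idist_ge0 Z x : (0 <= set_idist Z x)%E.
Proof.
rewrite leNgt; apply/negP => /set_idist_ltP[z _ /idist_eucl].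
by apply/negP; rewrite -leNgt eucl_ge0.
Qed.

(** The distance may be infinite; truncation makes it real without altering comparisons with
    thresholds up to [T]. *)
Definition trunc_idist Z (T : R) x : R := fine (Order.min (set_idist Z x) T%:E).

Lemma trunc_idist_in Z T x : 0 <= T -> 0 <= trunc_idist Z T x <= T.
Proof.
rewrite /trunc_idist; have := set_idist_ge0 Z x.
case: set_idist => [a| |]// a0 T0.
  rewrite -EFin_min/= le_min ge_min lexx orbT T0 andbT.
  by move: a0; rewrite lee_fin => ->.
by rewrite min_r ?leey//= T0 lexx.
Qed.

Lemma trunc_idist_lt Z T x s : s <= T ->
  (trunc_idist Z T x < s) = (set_idist Z x < s%:E)%E.
Proof.
rewrite /trunc_idist => sT; have := set_idist_ge0 Z x.
case: set_idist => [a| |]// a0.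
  by rewrite -EFin_min/= lte_fin gt_min (ltNge T) sT orbF.
by rewrite min_r ?leey//= ltNge sT.
Qed.

(* The comparison function is [c] on [Z] and [c + A e + q (d(Z, x))] elsewhere,
   with [q t = A t - (M + 1) t^2]. The jump [A e] makes it a supersolution also at
   distance less than [e] from [Z]; it satisfies the inequality with constant
   [M + 1 > M], so that an almost-maximum point of the difference suffices. *)
Lemma barrier_le Z (u : V -> R) (c M r e A K : R) :
  0 < e -> e <= r -> 0 <= M -> 4 * (M + 1) * r <= A ->
  (forall x, closure D x -> `|u x| <= K) ->
  (forall x, D x -> - (M * e ^+ 2) <= eps_inf_lap D e u x) ->
  (forall x, Z x -> u x <= c) ->
  (forall x, bdry D x -> (set_idist Z x < r%:E)%E -> u x <= c) ->
  (forall x, closure D x -> (r%:E <= set_idist Z x)%E ->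
    u x <= c + (A * r - (M + 1) * r ^+ 2)) ->
  forall x s, closure D x -> (set_idist Z x < s%:E)%E -> u x <= c + A * (e + s).
Proof.
move=> e0 er M0 Ar uK uL uZ ub ufar x0 s Dx0 x0s.
set B := M + 1 in Ar ufar *.
have B0 : 0 < B by rewrite /B; lra.
have r0 : 0 < r by exact: lt_le_trans er.
have A0 : 0 < A by apply: lt_le_trans Ar; rewrite !mulr_gt0.
(* The condition [4 * B * r <= A] makes [q] nondecreasing up to [2 * r], a range that contains
   [d x + e] whenever [d x < r]. *)
pose q t := A * t - B * t ^+ 2.
have q_mono t1 t2 : 0 <= t1 -> t1 <= t2 -> t2 <= 2 * r -> q t1 <= q t2.
  move=> t10 t12 t2r; rewrite -subr_ge0.
  rewrite (_ : _ - _ = (t2 - t1) * (A - B * (t1 + t2))); last by rewrite /q; ring.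
  apply: mulr_ge0; first by rewrite subr_ge0.
  rewrite subr_ge0; apply: le_trans Ar; rewrite [4 * B]mulrC -mulrA ler_pM2l//; lra.
have q0 : q 0 = 0 by rewrite /q; ring.
have q_ge0 t : 0 <= t -> t <= 2 * r -> 0 <= q t.
  by move=> t0 tr; rewrite -q0; apply: q_mono.
pose d := trunc_idist Z (2 * r).
have d_in x : 0 <= d x <= 2 * r by apply: trunc_idist_in; lra.
have d_ge0 x : 0 <= d x by case/andP: (d_in x).
have d_le x : d x <= 2 * r by case/andP: (d_in x).
have d_lt x t : t <= 2 * r -> (d x < t) = (set_idist Z x < t%:E)%E.
  exact: trunc_idist_lt.
have qd x : 0 <= q (d x) by apply: q_ge0.
have Ae : 0 < A * e by exact: mulr_gt0.
pose phi x := if `[< Z x >] then c else c + A * e + q (d x).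
have phi_ge x : c <= phi x.
  by rewrite /phi; case: asboolP => // _; have := qd x; lra.
have phi_le x t : d x <= t -> t <= 2 * r -> phi x <= c + A * e + q t.
  move=> dt t2; rewrite /phi; case: asboolP => _; last by rewrite lerD2l q_mono.
  by have := q_ge0 _ (le_trans (d_ge0 x) dt) t2; lra.
suff u_phi : u x0 <= phi x0.
  have dxs : d x0 <= s.
    have [s2|s2] := leP s (2 * r); last exact: le_trans (d_le x0) (ltW s2).
    by apply: ltW; rewrite d_lt.
  apply: (le_trans u_phi); apply: le_trans (phi_le _ _ (lexx _) (d_le _)) _.
  rewrite [A * (e + s)]mulrDr [leRHS]addrA lerD2l /q; apply: (@le_trans _ _ (A * d x0)).
    by rewrite lerBlDr lerDl mulr_ge0 ?sqr_ge0// ltW.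
  by rewrite ler_pM2l.
rewrite leNgt; apply/negP => lt_phi.
pose S := [set u x - phi x | x in closure D].
have Ssup : has_sup S.
  split; first by exists (u x0 - phi x0), x0.
  exists (K - c) => _ [x Dx <-]; apply: lerB (phi_ge x).
  exact: le_trans (ler_norm _) (uK x Dx).
set m := sup S.
have m0 : 0 < m.
  apply: (@lt_le_trans _ _ (u x0 - phi x0)); first by rewrite subr_gt0.
  by apply: sup_upper_bound => //; exists x0.
have um y : closure D y -> u y <= phi y + m.
  by move=> Dy; rewrite -lerBlDl; apply: sup_upper_bound => //; exists y.
have e20 : 0 < e ^+ 2 / 4 by rewrite divr_gt0 ?exprn_gt0.
(* The supremum [m] of [u - phi] need not be attained. With [eta <= m] the chosen point has
   [phi x < u x], which keeps it off [Z], off the boundary and at distance below [r]; with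
   [eta <= e ^+ 2 / 4] the error [2 * eta] is less than the surplus [e ^+ 2] from [B = M + 1]. *)
pose eta := Num.min m (e ^+ 2 / 4).
have eta0 : 0 < eta by rewrite lt_min m0.
have eta_m : eta <= m by rewrite ge_min lexx.
have eta_e : eta <= e ^+ 2 / 4 by rewrite ge_min lexx orbT.
have [_ [x Dx <-] xm] := sup_adherent eta0 Ssup.
rewrite -/m in xm.
have phix : phi x < u x by lra.
have nZx : ~ Z x.
  by move=> /[dup] Zx /uZ; rewrite leNgt (le_lt_trans (phi_ge x)).
have phixE : phi x = c + A * e + q (d x).
  by rewrite /phi; case: asboolP.
have dr : d x < r.
  rewrite ltNge; apply/negP => rd.
  have /ufar : (r%:E <= set_idist Z x)%E by rewrite leNgt -d_lt -?leNgt//; lra.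
  move=> /(_ Dx); rewrite -/(q r).
  have : q r <= q (d x) by apply: q_mono => //; exact: ltW.
  by lra.
have xr : (set_idist Z x < r%:E)%E by rewrite -d_lt//; lra.
have Ox : D x.
  apply: contrapT => nx; have /ub/(_ xr) : bdry D x by split.
  by rewrite leNgt (le_lt_trans (phi_ge x)).
have Bsup : has_sup (u @` iball D x e).
  split; first by exists (u x), x => //; split=> //; exact: idist_refl.
  by exists K => _ [y [Dy _] <-]; exact: le_trans (ler_norm _) (uK y Dy).
have Binf : has_lbound (u @` iball D x e).
  by exists (- K) => _ [y [Dy _] <-]; have := uK y Dy; rewrite ler_norml => /andP[].
have sup_le : sup (u @` iball D x e) <= c + A * e + q (d x + e) + m.
  apply: ge_sup => [|_ [y [Dy xy] <-]]; first by case: Bsup.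
  apply: (le_trans (um y Dy)); rewrite lerD2r; apply: phi_le; last by lra.
  rewrite leNgt; apply/negP => dy.
  have : d x < d y - e by lra.
  have dy2 := d_le y.
  rewrite d_lt; last by lra.
  move=> /set_idist_ltP[z Zz zx]; have := idist_triangle zx xy; rewrite subrK => zy.
  suff : d y < d y by rewrite ltxx.
  by rewrite d_lt//; apply/set_idist_ltP; exists z.
have inf_le y : closure D y -> (idist D x y < e%:E)%E ->
    inf (u @` iball D x e) <= phi y + m.
  by move=> Dy xy; apply: le_trans (um y Dy); apply: ge_inf => //; exists y.
have := uL x Ox; rewrite /eps_inf_lap => Lx.
have dx0 := d_ge0 x.
have Bde : 0 <= B * (d x * e) by rewrite !mulr_ge0 ?(ltW B0) ?(ltW e0).
(* If [d x < e], the ball meets [Z], where [phi] is only [c]: the infimum misses the jump [A * e],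
   and this loss replaces the value [q (d x - e)]. *)
have [ed|de] := leP e (d x); last first.
  have /set_idist_ltP[z Zz zx] : (set_idist Z x < e%:E)%E by rewrite -d_lt//; lra.
  have [Dz _] := idist_closure zx.
  have := inf_le z Dz; rewrite idist_sym => /(_ zx).
  rewrite {1}/phi; case: asboolP => // _ infz.
  have Bd : B * d x ^+ 2 <= A * d x.
    rewrite expr2 mulrA ler_wpM2r//; apply: le_trans Ar.
    by rewrite [4 * B]mulrC -mulrA ler_pM2l//; lra.
  have qE : q (d x + e) - 2 * q (d x) - A * e =
      (B * d x ^+ 2 - A * d x) - 2 * (B * (d x * e)) - B * e ^+ 2.
    by rewrite /q; ring.
  have BE : B * e ^+ 2 = M * e ^+ 2 + e ^+ 2 by rewrite /B; ring.
  by lra.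
(* The distance to [Z] need not be attained, so the point nearer to [Z] is found up to an error [h],
   which costs at most [A * h <= e ^+ 2 / 4]. *)
pose h := Num.min r (e ^+ 2 / 4 / A).
have h0 : 0 < h by rewrite lt_min r0 divr_gt0.
have hr : h <= r by rewrite ge_min lexx.
have hA : A * h <= e ^+ 2 / 4 by rewrite mulrC -ler_pdivlMr// ge_min lexx orbT.
have /set_idist_ltP[z Zz zx] : (set_idist Z x < (d x + h)%:E)%E.
  by rewrite -d_lt; lra.
have [|y [xy zy]] := idist_split zx e0; first by lra.
have [_ Dy] := idist_closure xy.
have dy : d y < d x + h - e by rewrite d_lt; [apply/set_idist_ltP; exists z|lra].
have infy := inf_le y Dy xy.
have phiy : phi y <= c + A * e + q (d x + h - e) by apply: phi_le; [exact: ltW|lra].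
have qE : q (d x + h - e) = q (d x - e) + A * h - B * (h * (2 * (d x - e) + h)).
  by rewrite /q; ring.
have Bh : 0 <= B * (h * (2 * (d x - e) + h)).
  by rewrite !mulr_ge0 ?(ltW B0) ?(ltW h0)//; lra.
(* The jumps [A * e] cancel here, and the second difference of the quadratic contradicts the lower
   bound on the operator. *)
have qE2 : q (d x + e) + q (d x - e) - 2 * q (d x) = - (2 * (B * e ^+ 2)).
  by rewrite /q; ring.
have BE : B * e ^+ 2 = M * e ^+ 2 + e ^+ 2 by rewrite /B; ring.
have Me : 0 <= M * e ^+ 2 by rewrite mulr_ge0 ?sqr_ge0.
by lra.
Qed.

End Barrier.

(** * Uniform bounds and asymptotic equicontinuity of the solutions *)

Section Equicontinuity.
Variables (R : realType) (n : nat) (D : set 'rV[R]_n).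
Notation V := 'rV[R]_n.
Implicit Types (x y z : V) (u g : V -> R) (e r s c M C A G d eta : R).

Lemma eps_inf_lapN e u x :
  eps_inf_lap D e (fun y => - u y) x = - eps_inf_lap D e u x.
Proof.
rewrite /eps_inf_lap /inf.
have N (E : set V) : [set - t | t in (fun y => - u y) @` E] = u @` E.
  by rewrite image_comp; apply: eq_imagel => y _ /=; rewrite opprK.
have N' (E : set V) : (fun y => - u y) @` E = [set - t | t in u @` E].
  by rewrite image_comp; exact: eq_imagel.
rewrite N N'; ring.
Qed.

Lemma barrier_dist_le (Z : set V) u c d M r e A C :
  0 < e -> e <= r -> 0 <= M -> 4 * (M + 1) * r <= A ->
  (forall x, closure D x -> `|u x| <= C) ->
  (forall x, D x -> `|eps_inf_lap D e u x| <= M * e ^+ 2) ->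
  (forall x, Z x -> `|u x - c| <= d) ->
  (forall x, bdry D x -> (set_idist D Z x < r%:E)%E -> `|u x - c| <= d) ->
  (forall x, closure D x -> (r%:E <= set_idist D Z x)%E ->
    `|u x - c| <= d + (A * r - (M + 1) * r ^+ 2)) ->
  forall x s, closure D x -> (set_idist D Z x < s%:E)%E ->
    `|u x - c| <= d + A * (e + s).
Proof.
move=> e0 er M0 Ar uC uL uZ ub ufar x s Dx xs; rewrite ler_norml; apply/andP; split.
  suff : - u x <= (d - c) + A * (e + s) by lra.
  apply: (@barrier_le _ _ D Z (fun y => - u y) (d - c) M r e A C) => //.
  - by move=> y /uC; rewrite normrN.
  - by move=> y /uL; rewrite eps_inf_lapN lerN2 ler_norml => /andP[].
  - by move=> y /uZ; rewrite ler_norml => /andP[]; lra.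
  - by move=> y by_ /(ub _ by_); rewrite ler_norml => /andP[]; lra.
  - by move=> y Dy /(ufar _ Dy); rewrite ler_norml => /andP[]; lra.
suff : u x <= (c + d) + A * (e + s) by lra.
apply: (@barrier_le _ _ D Z u (c + d) M r e A C) => //.
- by move=> y /uL; rewrite ler_norml => /andP[].
- by move=> y /uZ; rewrite ler_norml => /andP[]; lra.
- by move=> y by_ /(ub _ by_); rewrite ler_norml => /andP[]; lra.
- by move=> y Dy /(ufar _ Dy); rewrite ler_norml => /andP[]; lra.
Qed.

(** The barrier around the boundary reaches everywhere, since every point is within [r] of it. The
    resulting bound does not involve [C], hence is uniform over the solutions. *)
Lemma width_bound u M r e G C : 0 < e -> e <= r -> 0 <= M ->
  (width D < r%:E)%E ->
  (forall x, closure D x -> `|u x| <= C) ->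
  (forall x, D x -> `|eps_inf_lap D e u x| <= M * e ^+ 2) ->
  (forall x, bdry D x -> `|u x| <= G) ->
  forall x, closure D x -> `|u x| <= G + 4 * (M + 1) * r * (r + r).
Proof.
move=> e0 er M0 wr uC uL uG x Dx.
have r0 : 0 < r by exact: lt_le_trans er.
have near_bdry y : closure D y -> (set_idist D (bdry D) y < r%:E)%E.
  move=> Dy; have [Oy|nOy] := pselect (D y).
    by apply: le_lt_trans wr; apply: ereal_sup_ubound; exists y.
  by apply/set_idist_ltP; exists y => //; exact: idist_refl.
rewrite -[u x]subr0; apply: (@le_trans _ _ (G + 4 * (M + 1) * r * (e + r))).
  apply: (@barrier_dist_le (bdry D) u 0 G M r e _ C) => //.
  - by move=> y yD; rewrite subr0 uG.
  - by move=> y yD _; rewrite subr0 uG.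
  - by move=> y Dy; rewrite leNgt near_bdry.
  - exact: near_bdry.
have M4 : 0 <= 4 * (M + 1) by lra.
by rewrite lerD2l ler_wpM2l ?lerD2r// mulr_ge0// ltW.
Qed.

(** The barrier around the single point [z]. The term [4 * C / r] in the slope lifts it above the
    trivial bound [2 * C] for [u - c] at distance [r] and beyond. *)
Lemma local_estimate u z c d M r e C A : 0 < e -> e <= r -> 0 <= M ->
  4 * (M + 1) * r + 4 * C / r <= A -> `|c| <= C -> 0 <= d ->
  (forall x, closure D x -> `|u x| <= C) ->
  (forall x, D x -> `|eps_inf_lap D e u x| <= M * e ^+ 2) ->
  `|u z - c| <= d ->
  (forall x, bdry D x -> (idist D z x < r%:E)%E -> `|u x - c| <= d) ->
  forall x s, (idist D z x < s%:E)%E -> `|u x - c| <= d + A * (e + s).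
Proof.
move=> e0 er M0 Ar cC d0 uC uL uz ub x s zx.
have r0 : 0 < r by exact: lt_le_trans er.
have C0 : 0 <= C by exact: le_trans cC.
have C4 : 0 <= 4 * C / r by apply: divr_ge0; [lra|exact: ltW].
have Ar' : 4 * (M + 1) * r ^+ 2 + 4 * C <= A * r.
  rewrite -(ler_pM2r r0) in Ar; apply: le_trans Ar.
  by rewrite [leRHS]mulrDl divfK ?gt_eqF// expr2 mulrA.
have Mr : 0 <= (M + 1) * r ^+ 2 by apply: mulr_ge0; [lra|exact: sqr_ge0].
apply: (@barrier_dist_le [set z] u c d M r e A C) => //.
- by lra.
- by move=> y ->.
- by move=> y; rewrite set_idist1; exact: ub.
- move=> y Dy _; apply: (le_trans (ler_normB _ _)).
  by have := uC y Dy; lra.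
- by case: (idist_closure zx).
- by rewrite set_idist1.
Qed.

(** The exit time is the infimum of the times outside [D]: openness puts the exit point outside [D],
    and the earlier points put it in the closure. *)
Lemma segment_exit x y : open D -> D y -> ~ D x -> exists2 t, 0 <= t <= 1 &
  bdry D (y + t *: (x - y)) /\
  forall s, 0 <= s <= t -> closure D (y + s *: (x - y)).
Proof.
move=> oD Dy nDx; pose h (s : R) := y + s *: (x - y).
have hc : continuous h.
  move=> t; apply: cvgD; first exact: cvg_cst.
  by apply: cvgZr_tmp; exact: cvg_id.
pose T := [set s | 0 <= s /\ ~ D (h s)].
have T1 : T 1 by split => //; rewrite /h scale1r addrC subrK.
have T0 : lbound T 0 by move=> s [].
have Ti : has_inf T by split; [exists 1|exists 0].
pose t := inf T.
have t0 : 0 <= t by apply: lb_le_inf => //; exists 1.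
have t1 : t <= 1 by apply: ge_inf => //; exists 0.
have lt_t s : 0 <= s -> s < t -> D (h s).
  move=> s0 st; apply: contrapT => nD.
  suff : t <= s by rewrite leNgt st.
  by apply: ge_inf; [exists 0|split].
have nDt : ~ D (h t).
  move=> Dt.
  have : nbhs t (h @^-1` D) by apply: hc; apply: open_nbhs_nbhs.
  move=> /nbhs_ballP[d /= d0 dD].
  have [s [s0 nDs] sd] := inf_adherent d0 Ti.
  have ts : t <= s by apply: ge_inf; [exists 0|split].
  apply: nDs; apply: dD; rewrite /ball/= distrC ger0_norm ?subr_ge0//.
  by rewrite ltrBlDl.
have t_gt0 : 0 < t.
  rewrite lt_def t0 andbT; apply/eqP => tE; apply: nDt.
  by rewrite tE /h scale0r addr0.
have Dt : closure D (h t).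
  move=> P /hc /nbhs_ballP[d /= d0 dP].
  pose s := Num.max 0 (t - d / 2).
  have s0 : 0 <= s by rewrite le_max lexx.
  have st : s < t by rewrite gt_max t_gt0 ltrBlDr ltrDl divr_gt0.
  exists (h s); split; first exact: lt_t.
  apply: dP; rewrite /ball/= gtr0_norm ?subr_gt0// ltrBlDl -ltrBlDr.
  by rewrite lt_max ltrD2l ltrN2 ltr_pdivrMr// ltr_pMr ?ltr1n// orbT.
exists t; first by rewrite t0.
split => // s /andP[s0]; rewrite le_eqVlt => /predU1P[->//|st].
exact/subset_closure/lt_t.
Qed.

Lemma solution_equicontinuous g M C x : open D -> 0 <= M -> 0 < C ->
  {within bdry D, continuous g} -> closure D x ->
  forall eta, 0 < eta -> exists2 d, 0 < d & forall u e, 0 < e -> e < d ->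
    (forall y, closure D y -> `|u y| <= C) ->
    (forall y, D y -> `|eps_inf_lap D e u y| <= M * e ^+ 2) ->
    (forall y, bdry D y -> u y = g y) ->
    forall y, closure D y -> `|y - x| < d -> `|u y - u x| <= eta.
Proof.
move=> oD M0 C0 gc Dx eta eta0.
set k := Num.sqrt n%:R : R.
have k0 : 0 <= k by exact: sqrtr_ge0.
have k1 : 0 < k + 1 by lra.
have M1 : 0 < M + 1 by lra.
(* Passes from sup norm balls to Euclidean ones; [k + 1] is positive even in dimension zero. *)
have eucl_lt y z s : 0 < s -> `|y - z| < s / (k + 1) -> eucl (y - z) < s.
  move=> s0; rewrite ltr_pdivlMr// => yz; apply: le_lt_trans (eucl_le_norm _) _.
  apply: le_lt_trans yz; rewrite mulrDr mulr1 -/k mulrC lerDl.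
  exact: normr_ge0.
have div_le s : 0 < s -> s / (k + 1) <= s.
  by move=> s0; rewrite ler_pdivrMr// ler_pMr// lerDr.
(* At an interior point, compare around [x] itself with [c = u x], in a ball free of boundary
   points. *)
have [Ox|nOx] := pselect (D x).
  have [r /= r0 rD] : exists2 r : R, 0 < r & forall y, `|y - x| < r -> D y.
    have /nbhs_ballP[r /= r0 rD] := open_nbhs_nbhs (conj oD Ox).
    by exists r => // y yx; apply: rD; rewrite -ball_normE/= distrC.
  pose A := 4 * (M + 1) * r + 4 * C / r.
  have A0 : 0 < A by rewrite addr_gt0 ?divr_gt0 ?mulr_gt0.
  pose s : R := Num.min r (eta / 2 / A).
  have s0 : 0 < s by rewrite lt_min r0 !divr_gt0.
  have sr : s <= r by rewrite ge_min lexx.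
  have sA : A * s <= eta / 2 by rewrite mulrC -ler_pdivlMr// ge_min lexx orbT.
  exists (s / (k + 1)); first by rewrite divr_gt0.
  move=> u e e0 ed uC uL ug y Dy yx.
  have es : e < s by exact: lt_le_trans (div_le _ s0).
  apply: (@le_trans _ _ (0 + A * (e + s))).
    apply: (@local_estimate u x (u x) 0 M r e C A) => //.
    - by lra.
    - exact: uC.
    - by rewrite subrr normr0.
    - move=> p [_ nDp] /idist_eucl xp; exfalso; apply/nDp/rD.
      exact: le_lt_trans (norm_le_eucl _) xp.
    - apply: idist_segment; last exact: eucl_lt.
      move=> t /andP[t0 t1]; apply/subset_closure/rD.
      rewrite addrC addKr normrZ ger0_norm//.
      apply: (@le_lt_trans _ _ `|y - x|).
        by rewrite ler_piMl.
      by apply: lt_le_trans yx _; exact: le_trans (div_le _ s0) sr.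
  rewrite add0r mulrDr; have : A * e <= A * s by rewrite ler_pM2l// ltW.
  by lra.
have bx : bdry D x by split.
have [r0 /= r00 r0g] : exists2 r : R, 0 < r & forall p, bdry D p -> `|p - x| < r ->
    `|g p - g x| <= eta / 2.
  have /subspace_continuousP/(_ x bx)/cvgr_dist_le/(_ (eta / 2)) := gc.
  rewrite divr_gt0// => /(_ isT); rewrite near_withinE => /nbhs_ballP[r /= r0 rg].
  exists r => // p bp px; rewrite distrC; apply: rg => //.
  by rewrite -ball_normE/= distrC.
(* At a boundary point the comparison is centred at an exit point [p] within [r] of [x]; halving
   [r0] keeps the [r]-neighbourhood of [p] where [g] is close to [g x]. *)
pose r := r0 / 2.
have rr : 0 < r by rewrite divr_gt0.
pose A := 4 * (M + 1) * r + 4 * C / r.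
have A0 : 0 < A by rewrite addr_gt0 ?divr_gt0 ?mulr_gt0.
pose s : R := Num.min r (eta / 4 / A).
have s0 : 0 < s by rewrite lt_min rr !divr_gt0.
have sr : s <= r by rewrite ge_min lexx.
have sA : A * s <= eta / 4 by rewrite mulrC -ler_pdivlMr// ge_min lexx orbT.
exists (s / (k + 1)); first by rewrite divr_gt0.
move=> u e e0 ed uC uL ug y Dy yx.
have es : e < s by exact: lt_le_trans (div_le _ s0).
have yxs : `|y - x| < s by exact: lt_le_trans (div_le _ s0).
have r0E : r0 = r + r by rewrite /r; lra.
have ug' p : bdry D p -> `|p - x| < r0 -> `|u p - u x| <= eta / 2.
  by move=> bp px; rewrite !ug//; exact: r0g.
have [Oy|nOy] := pselect (D y); last first.
  by apply: le_trans (ug' _ _ _) _ => //; lra.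
have [t /andP[t0 t1] [bp seg]] := segment_exit oD Oy nOx.
set p := y + t *: (x - y) in bp.
have ypE : y - p = t *: (y - x).
  by rewrite /p opprD addrA subrr add0r -scalerN opprB.
have pxE : p - x = (1 - t) *: (y - x).
  by rewrite scalerBl scale1r -ypE opprB [RHS]addrC addrA subrK.
have px : `|p - x| < s.
  rewrite pxE normrZ ger0_norm ?subr_ge0//; apply: le_lt_trans yxs.
  by rewrite ler_piMl// gerBl.
have yp : eucl (y - p) < s.
  apply: eucl_lt => //; apply: le_lt_trans yx.
  by rewrite ypE normrZ ger0_norm// ler_piMl.
(* The segment from [p] to [y] is the part of the segment before its exit, hence stays in the
   closure. *)
have py : (idist D p y < s%:E)%E.
  apply: idist_segment => // v /andP[v0 v1].
  have -> : p + v *: (y - p) = y + (t * (1 - v)) *: (x - y).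
    rewrite ypE /p -addrA scalerA -(opprB x y) scalerN -scalerBl.
    by rewrite mulrBr mulr1 [v * t]mulrC.
  apply: seg; rewrite mulr_ge0 ?subr_ge0//= -[leRHS]mulr1 ler_wpM2l//.
  by rewrite gerBl.
apply: (@le_trans _ _ (eta / 2 + A * (e + s))).
  apply: (@local_estimate u p (u x) (eta / 2) M r e C A) => //.
  - by lra.
  - exact: uC.
  - by lra.
  - by apply: ug' => //; lra.
  - move=> q bq /idist_eucl pq; apply: ug' => //.
    rewrite -(subrK p q) -addrA; apply: le_lt_trans (ler_normD _ _) _.
    by have := norm_le_eucl (q - p); lra.
rewrite mulrDr; have : A * e <= A * s by rewrite ler_pM2l// ltW.
by lra.
Qed.

End Equicontinuity.

(** * Compactness for asymptotically equicontinuous sequences *)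

Section AsymptoticAscoli.
Variables (R : realType) (n : nat).
Notation V := 'rV[R]_n.

(** Compactness of the segment gives a cluster point, and along an ultrafilter a cluster point is a
    limit. *)
Lemma ultrafilter_bounded_lim (T : Type) (F : set_system T) (a : T -> R) (C : R) :
  UltraFilter F -> F [set i | `|a i| <= C] ->
  exists l : R, forall eta : R, 0 < eta -> F [set i | `|a i - l| < eta].
Proof.
move=> FU aC.
have FP : ProperFilter F by exact: ultra_proper.
have aF : (a @ F) `[- C, C]%classic.
  apply: filterS aC => i aiC; rewrite /preimage/= in_itv/= -ler_norml.
  exact: aiC.
have [l [_ lcl]] := segment_compact (fmap_proper_filter a FP) aF.
exists l => eta eta0.
have [//|nF] := in_ultra_setVsetC [set i | `|a i - l| < eta] FU.
have : (a @ F) [set b | ~ (`|b - l| < eta)] by exact: nF.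
move=> /lcl/(_ (nbhsx_ballx l eta eta0))[b [/= nb]].
by rewrite -ball_normE/= distrC.
Qed.

(* An Arzela-Ascoli theorem for possibly discontinuous functions: a limit along an
   ultrafilter replaces the diagonal argument. *)
Lemma asymptotic_ascoli (X : set V) (u : nat -> V -> R) (C : R) : closed X ->
  (\forall i \near \oo, forall x, X x -> `|u i x| <= C) ->
  (forall x, X x -> forall eta : R, 0 < eta -> exists2 d : R, 0 < d &
    \forall i \near \oo, forall y, X y -> `|y - x| < d -> `|u i y - u i x| <= eta) ->
  exists (phi : nat -> nat) (v : V -> R),
    (forall k, (phi k < phi k.+1)%N) /\
    {within X, continuous v} /\
    (forall K : set V, compact K -> K `<=` X ->
       forall e : R, 0 < e -> exists N : nat, forall k, (N <= k)%N ->
         forall x, K x -> `|u (phi k) x - v x| < e).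
Proof.
move=> Xc uC ueq.
have [F [FU Foo]] : exists F : set_system nat, UltraFilter F /\ \oo `<=` F.
  exact: (@ultraFilterLemma _ \oo).
have FP : ProperFilter F by exact: ultra_proper.
have [v vP] : exists v : V -> R, forall x, X x ->
    forall eta : R, 0 < eta -> F [set i | `|u i x - v x| < eta].
  suff /choice[v vP] : forall x, exists l : R, X x ->
      forall eta : R, 0 < eta -> F [set i | `|u i x - l| < eta] by exists v.
  move=> x.
  have [Xx|nXx] := pselect (X x); last by exists 0.
  have [|l lP] := @ultrafilter_bounded_lim _ F (u ^~ x) C FU.
    by apply: Foo; apply: filterS uC => i; exact.
  by exists l => _.
have veq x : X x -> forall eta : R, 0 < eta -> exists2 d : R, 0 < d &
    (\forall i \near F, forall y, X y -> `|y - x| < d -> `|u i y - u i x| <= eta) /\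
    forall y, X y -> `|y - x| < d -> `|v y - v x| <= 3 * eta.
  move=> Xx eta eta0; have [d d0 /Foo ud] := ueq x Xx eta eta0.
  exists d => //; split => // y Xy yx.
  have Fx := vP x Xx eta eta0; have Fy := vP y Xy eta eta0.
  have [i [[/= ix iy] iud]] := filter_ex (filterI (filterI Fx Fy) ud).
  have := iud y Xy yx; move: ix iy; rewrite !ltr_norml !ler_norml.
  by move=> /andP[? ?] /andP[? ?] /andP[? ?]; apply/andP; split; lra.
(* Local estimates are patched by compactness: with tolerance [eta / 6] the errors are one sixth for
   [u i], one sixth at [x] and three sixths for [v]. *)
have unif (K : set V) : compact K -> K `<=` X -> forall eta : R, 0 < eta ->
    F [set i | forall x, K x -> `|u i x - v x| < eta].
  move=> /compact_near_coveringP Kc KX eta eta0.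
  have Fuv : \near F, K `<=` (fun x => X x -> `|u F x - v x| < eta).
    apply: (Kc nat F (fun i x => X x -> `|u i x - v x| < eta)).
    move=> x Kx; have Xx := KX _ Kx.
    have eta6 : 0 < eta / 6 by rewrite divr_gt0.
    have [d d0 [ud vd]] := veq x Xx _ eta6.
    have Fx := vP x Xx _ eta6.
    exists (ball x d, [set i | (forall y, X y -> `|y - x| < d ->
        `|u i y - u i x| <= eta / 6) /\ `|u i x - v x| < eta / 6]).
      by split; [exact: nbhsx_ballx|exact: filterI].
    move=> [y i] /= [yx [uy ux]] Xy.
    have {}yx : `|y - x| < d by move: yx; rewrite -ball_normE/= distrC.
    have := uy y Xy yx; have := vd y Xy yx; move: ux.
    rewrite !ltr_norml !ler_norml.
    by move=> /andP[? ?] /andP[? ?] /andP[? ?]; apply/andP; split; lra.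
  by apply: filterS Fuv => i iK x Kx; apply: iK => //; exact: KX.
pose Kk (k : nat) := X `&` [set x : V | `|x| <= k%:R].
have Kcompact k : compact (Kk k).
  apply: bounded_closed_compact.
    exists k%:R; split => // y ky x [_ xk]; exact: le_trans xk (ltW ky).
  apply: closedI => //.
  apply: (@preimage_closed _ _ (fun x : V => `|x|) [set y | y <= k%:R]).
    by move=> x _; exact: norm_continuous.
  exact: closed_le.
(* Members of [F] meet every tail, so good indices occur arbitrarily late; restarting after [phi k']
   makes [phi] strictly increasing. *)
have sel N k : {i | (N <= i)%N /\ forall x, Kk k x -> `|u i x - v x| < k.+1%:R^-1}.
  apply: cid.
  have k1 : (0 : R) < k.+1%:R^-1 by rewrite invr_gt0.
  have FN : F [set i | (N <= i)%N] by apply: Foo; exact: nbhs_infty_ge.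
  have FK := unif _ (Kcompact k) (@subIsetl _ _ _) _ k1.
  have [i [/= Ni iK]] := filter_ex (filterI FN FK).
  by exists i.
pose phi := fix phi k := 
  if k is k'.+1 then sval (sel (phi k').+1 k) else sval (sel 0%N 0%N).
have phiP k x : Kk k x -> `|u (phi k) x - v x| < k.+1%:R^-1.
  by case: k => [|k]; exact: (svalP (sel _ _)).2.
exists phi, v; split; last split.
- by move=> k; exact: (svalP (sel _ _)).1.
- apply/subspace_continuousP => x Xx; apply/cvgrPdist_le => eta eta0.
  have [|d d0 [_ vd]] := veq x Xx (eta / 3); first by rewrite divr_gt0.
  rewrite near_withinE; apply/nbhs_ballP; exists d => // y yx Xy.
  rewrite distrC; have := vd y Xy; rewrite [3 * _]mulrC divfK//; apply.
  by move: yx; rewrite -ball_normE/= distrC.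
- move=> K Kc KX e e0.
  have [M [_ /(_ (M + 1))]] := compact_bounded Kc.
  rewrite ltrDl => /(_ ltr01) KM.
  (* Beyond this index [K] lies in [Kk k] and the tolerance [k.+1%:R^-1] is below [e]. *)
  pose N := Num.truncn (Num.max (M + 1) e^-1).
  exists N.+1 => k Nk x Kx.
  have kN : Num.max (M + 1) e^-1 < k%:R.
    apply: lt_le_trans (truncnS_gt _) _.
    by rewrite ler_nat.
  move: kN; rewrite gt_max => /andP[kM ke].
  apply: (@lt_trans _ _ k.+1%:R^-1).
    apply: phiP; split; first exact: KX.
    by apply: le_trans (KM x Kx) (ltW kM).
  rewrite invf_plt ?posrE//; apply: lt_trans ke _.
  by rewrite ltr_nat.
Qed.

End AsymptoticAscoli.

(** * Assembly: uniform bound, equicontinuity, extraction *)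

Theorem theorem1p3 (R : realType) (n : nat) (Omega : set 'rV[R]_n)
  (f : 'rV[R]_n -> R) (g : 'rV[R]_n -> R) (eps : nat -> R)
  (u : nat -> 'rV[R]_n -> R) :
  domain Omega ->
  (width Omega < +oo)%E ->
  (exists M : R, forall x, Omega x -> `|f x| <= M) ->
  {within bdry Omega, continuous g} ->
  (exists M : R, forall x, bdry Omega x -> `|g x| <= M) ->
  (forall i, 0 < eps i) ->
  eps @ \oo --> 0 ->
  (forall i, exists M : R, forall x, closure Omega x -> `|u i x| <= M) ->
  (forall i x, Omega x -> eps_inf_lap Omega (eps i) (u i) x = eps i ^+ 2 * f x) ->
  (forall i x, bdry Omega x -> u i x = g x) ->
  exists (phi : nat -> nat) (v : 'rV[R]_n -> R),
    (forall k, (phi k < phi k.+1)%N) /\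
    {within closure Omega, continuous v} /\
    (forall K : set 'rV[R]_n, compact K -> K `<=` closure Omega ->
       forall e : R, 0 < e -> exists N : nat, forall k, (N <= k)%N ->
         forall x, K x -> `|u (phi k) x - v x| < e).
Proof.
move=> [oO [_ [x0 Ox0]]] wO [M fM] gc [G gG] eps0 epsc ub uL ug.
have M0 : 0 <= M by apply: le_trans (fM x0 Ox0).
have [r r0 wr] : exists2 r : R, 0 < r & (width Omega < r%:E)%E.
  move: wO; case: (width Omega) => [w| |]// _; last by exists 1; rewrite ?ltNyr.
  exists (`|w| + 1); first by rewrite ltr_wpDl.
  by rewrite lte_fin; apply: le_lt_trans (ler_norm w) _; rewrite ltrDl.
have uLM i x : Omega x -> `|eps_inf_lap Omega (eps i) (u i) x| <= M * eps i ^+ 2.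
  move=> Ox; rewrite uL// normrM ger0_norm ?sqr_ge0// mulrC.
  by rewrite ler_wpM2r ?sqr_ge0// fM.
have eps_lt d : 0 < d -> \forall i \near \oo, eps i < d.
  by move=> d0; have /cvgr_lt/(_ d d0) := epsc.
(* The absolute value matters when the boundary is empty, as [G] may then be negative. *)
pose C := `|G| + 4 * (M + 1) * r * (r + r).
have C0 : 0 < C.
  have M1 : 0 < 4 * (M + 1) by lra.
  by apply: ltr_wpDl => //; apply: mulr_gt0; [exact: mulr_gt0|exact: addr_gt0].
have uC : \forall i \near \oo, forall x, closure Omega x -> `|u i x| <= C.
  apply: filterS (eps_lt r r0) => i er; have [K uK] := ub i.
  apply: (@width_bound _ _ Omega (u i) M r (eps i) `|G| K) => //.
  - exact: ltW.
  - by move=> x /uLM.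
  - by move=> x bx; rewrite ug// (le_trans (gG x bx))// ler_norm.
apply: (@asymptotic_ascoli R n (closure Omega) u C) => //.
  exact: closed_closure.
move=> x Dx eta eta0.
have [d d0 ueq] := solution_equicontinuous oO M0 C0 gc Dx eta0.
exists d => //; apply: filterS2 uC (eps_lt d d0) => i uC ed.
by apply: ueq => //; [exact: ed|move=> y /uLM|move=> y; exact: ug].
Qed.
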